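(* Let $\mathcal V$ be a multiplicative Poisson vertex algebra with $\lambda$-bracket $\{\cdot\,_\lambda\,\cdot\}_3^{(L)}$, and let $L(S)\in\mathcal V((S^{-1}))$ or $L(S)\in\mathcal V((S))$ be a pseudodifference operator satisfying the multiplicative 3-Adler identity $$\{L(z)_\lambda L(w)\}_3^{(L)}=L(w\lambda S)L(z)\,\delta_+\Big(\frac{w\lambda S}z\Big)\Big(L^*\Big(\frac\lambda z\Big)-\frac{w\lambda S}zL(w)\Big)-\Big(L(z)-L(w\lambda S)\frac{w\lambda S}z\Big)\delta_+\Big(\frac{w\lambda S}z\Big)L(w)L^*\Big(\frac\lambda z\Big).$$ Define $h_n\in\mathcal V$, $n\in\mathbb Z_{\ge0}$, by $h_n=-\frac1n\,\mathrm{mRes}_z L^n(z)$ for $n\ne0$ and $h_0=0$. Then: (a) All the elements $\int h_n$ are Hamiltonian functionals in involution: $\{\int h_m,\int h_n\}_3^{(L)}=0$ for all $m,n\in\mathbb Z_{\ge0}$. (b) The corresponding hierarchy of compatible Hamiltonian equations satisfies $$\frac{dL(w)}{dt_n}=\{\textstyle\int h_n,L(w)\}_3^{(L)}=[(L^{n+1})_+,L](w),\qquad n\in\mathbb Z_{\ge0}$$ (the right-hand side is the symbol of the commutator of difference operators), and the Hamiltonian functionals $\int h_n$, $n\in\mathbb Z_{\ge0}$, are integrals of motion of all these equations.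
   Context: The base field $\mathbb F$ has characteristic $0$. A multiplicative Poisson vertex algebra (mPVA) is a unital commutative associative algebra $\mathcal V$ with an automorphism $S$ and a linear map $\mathcal V\otimes\mathcal V\to\mathcal V[\lambda,\lambda^{-1}]$, $a\otimes b\mapsto\{a_\lambda b\}$, satisfying: $\{S(a)_\lambda b\}=\lambda^{-1}\{a_\lambda b\}$, $\{a_\lambda S(b)\}=\lambda S\{a_\lambda b\}$; $\{a_\lambda bc\}=\{a_\lambda b\}c+\{a_\lambda c\}b$; $\{b_\lambda a\}=-\sum_nS^{-n}(c_n)\lambda^{-n}$ if $\{a_\lambda b\}=\sum_nc_n\lambda^n$; $\{a_\lambda\{b_\mu c\}\}-\{b_\mu\{a_\lambda c\}\}=\{\{a_\lambda b\}_{\lambda\mu}c\}$. Hamiltonian functionals are elements of $\mathcal V/(S-1)\mathcal V$, with quotient map $\int$. This space carries the Lie bracket $\{\int a,\int b\}=\int\{a_\lambda b\}|_{\lambda=1}$, and acts on $\mathcal V$ by derivations commuting with $S$ by $\{\int a,b\}=\{a_\lambda b\}|_{\lambda=1}$. The Hamiltonian equation of $\int h$ is $\frac{du}{dt}=\{\int h,u\}$, $u\in\mathcal V$; $\int g$ is an integral of motion if $\{\int h,\int g\}=0$; Hamiltonian equations are compatible if the corresponding derivations commute. $\{\int h,L(w)\}$ means the action on the coefficients of $L(w)$. $\mathcal V((S))$ and $\mathcal V((S^{-1}))$ are the algebras of Laurent series in $S$, respectively $S^{-1}$, with coefficients in $\mathcal V$ on the left and product determined by $S\circ f=S(f)S$.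 For $A(S)=\sum_na_nS^n$: symbol $A(z)=\sum_na_nz^n$, formal adjoint $A^*(S)=\sum_nS^{-n}\circ a_n$, positive part $A_+=\sum_{n\ge0}a_nS^n$, $\mathrm{mRes}_zA(z)=a_0$; $L^n(z)$ is the symbol of the $n$-th power of $L(S)$. $\delta_+(x)=\sum_{k\ge0}x^k$. In the 3-Adler identity, for $L(S)=\sum_nu_nS^n$: $L(w\lambda S)=\sum_nu_nw^n\lambda^nS^n$, $L^*(\lambda/z)=\sum_nS^{-n}(u_n)\lambda^{-n}z^n$, $\delta_+(w\lambda S/z)=\sum_{k\ge0}w^k\lambda^kz^{-k}S^k$, each $S$ acts on all coefficients written to its right, and $\{L(z)_\lambda L(w)\}=\sum_{i,j}\{{u_i}_\lambda u_j\}z^iw^j$.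
   Formalization: The Lax equation in (b) is stated only for n ≥ 1: since h_0 = 0, at n = 0 it would say [L_+, L] = 0, which fails for V = F[x]/(x³), S(x) = −x, zero bracket, L = x + xS^{-1}. *)

(* Defs.v *)
From HB Require Import structures.
From mathcomp Require Import all_boot all_order all_algebra.
From mathcomp Require Import finmap ring_quotient generic_quotient.
From mathcomp Require Import boolp classical_sets functions cardinality fsbigop.

Set Implicit Arguments.
Unset Strict Implicit.
Unset Printing Implicit Defensive.

Import GRing.Theory.
Local Open Scope classical_set_scope.
Local Open Scope quotient_scope.
Local Open Scope ring_scope.

Definition int_iter (T : Type) (f g : T -> T) (n : int) (x : T) : T :=
  match n with Posz k => iter k f x | Negz k => iter k.+1 g x end.

(* Formal series are represented by their families of coefficients, and all
   infinite sums by the finitely supported sums [\sum_(i \in A) F i], which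
   have a junk value (0) when [F] has infinite support in [A].
   [bracket a b n] is the coefficient of lambda^n in {a_lambda b}; the axioms
   are the defining identities, read off coefficient by coefficient.  In
   [bracket_jacobi] the coefficient is that of lambda^m mu^n. *)
Record mPVA (F : fieldType) (V : comAlgType F) := MPVA {
  shift : {lrmorphism V -> V};
  shift_inv : V -> V;
  shiftK : cancel shift shift_inv;
  shift_invK : cancel shift_inv shift;
  bracket : V -> V -> int -> V;
  bracket_finite : forall a b, finite_set [set n | bracket a b n != 0];
  bracket_linearl : forall (k : F) a a' b n,
    bracket (k *: a + a') b n = k *: bracket a b n + bracket a' b n;
  bracket_linearr : forall (k : F) a b b' n,
    bracket a (k *: b + b') n = k *: bracket a b n + bracket a b' n;
  bracket_shiftl : forall a b n, bracket (shift a) b n = bracket a b (n + 1);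
  bracket_shiftr : forall a b n,
    bracket a (shift b) n = shift (bracket a b (n - 1));
  bracket_leibniz : forall a b c n,
    bracket a (b * c) n = bracket a b n * c + bracket a c n * b;
  bracket_skew : forall a b n,
    bracket b a n = - int_iter shift shift_inv n (bracket a b (- n));
  bracket_jacobi : forall a b c m n,
    bracket a (bracket b c n) m - bracket b (bracket a c m) n
    = bracket (bracket a b (m - n)) c n
}.

Section Definitions.
Variables (F : fieldType) (V : comAlgType F) (P : mPVA V).

(* S^n *)
Definition shiftz : int -> V -> V := int_iter (shift P) (shift_inv P).

(* {a_lambda b} at lambda = 1 *)
Definition bracket1 (a b : V) : V := \sum_(n \in [set: int]) bracket P a b n.

Definition total_difference : {pred V} :=
  fun a => `[< exists b : V, a = shift P b - b >].

Lemma total_difference_zmod_closed : zmod_closed total_difference.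
Proof.
split=> [|a b].
  by apply/asboolP; exists 0; rewrite raddf0 subrr.
move=> /asboolP[c ->] /asboolP[d ->]; apply/asboolP; exists (c - d).
by rewrite [in RHS]raddfB opprD addrACA -opprD.
Qed.

HB.instance Definition _ :=
  GRing.isZmodClosed.Build V total_difference total_difference_zmod_closed.

Definition functional := Quotient.quot total_difference.
HB.instance Definition _ := GRing.Zmodule.on functional.

(* The class of [a] in V / (S - 1) V *)
Definition intf (a : V) : functional := \pi_(Quotient.quot total_difference) a.

(* Both operations are independent of the chosen representatives: see
   [actE] and [lieE]. *)
Definition act (f : functional) (b : V) : V :=
  bracket1 (repr (f : Quotient.quot total_difference)) b.
Definition lie (f g : functional) : functional :=
  intf (act f (repr (g : Quotient.quot total_difference))).

Definition compatible (f g : functional) : Prop :=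
  forall u, act f (act g u) = act g (act f u).
Definition integral_of_motion (f g : functional) : Prop := lie f g = 0.

Definition pseudodiff := int -> V.

Definition laurent_S (A : pseudodiff) : Prop :=
  exists N : int, forall n, n < N -> A n = 0.
Definition laurent_Sinv (A : pseudodiff) : Prop :=
  exists N : int, forall n, N < n -> A n = 0.

(* (a S^i) o (b S^j) = a S^i(b) S^(i + j) *)
Definition pd_mul (A B : pseudodiff) : pseudodiff :=
  fun n => \sum_(i \in [set: int]) A i * shiftz i (B (n - i)).
Definition pd_one : pseudodiff := fun n => if n == 0 then 1 else 0.
Definition pd_exp (A : pseudodiff) (n : nat) : pseudodiff :=
  iter n (pd_mul A) pd_one.
Definition pd_comm (A B : pseudodiff) : pseudodiff :=
  fun n => pd_mul A B n - pd_mul B A n.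
Definition pd_pos (A : pseudodiff) : pseudodiff :=
  fun n => if 0 <= n then A n else 0.
Definition mres (A : pseudodiff) : V := A 0.

(* [X i j l] is the coefficient of z^i w^j lambda^l.  For [L] in V((S)) or in
   V((S^-1)) every sum occurring in [adler3_rhs L i j l] has finite support. *)

Definition series3 := int -> int -> int -> V.

Definition sub3 (X Y : series3) : series3 := fun i j l => X i j l - Y i j l.
Definition one3 : series3 :=
  fun i j l => if [&& i == 0, j == 0 & l == 0] then 1 else 0.

Variable L : pseudodiff.

(* X |-> L(z) X *)
Definition mul_Lz (X : series3) : series3 := fun i j l =>
  \sum_(n \in [set: int]) L n * X (i - n) j l.
(* X |-> L(w) X *)
Definition mul_Lw (X : series3) : series3 := fun i j l =>
  \sum_(n \in [set: int]) L n * X i (j - n) l.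
(* X |-> L(w lambda S) X *)
Definition mul_LwS (X : series3) : series3 := fun i j l =>
  \sum_(n \in [set: int]) L n * shiftz n (X i (j - n) (l - n)).
(* X |-> L^*(lambda / z) X *)
Definition mul_Ladj (X : series3) : series3 := fun i j l =>
  \sum_(n \in [set: int]) shiftz (- n) (L n) * X (i - n) j (l + n).
(* X |-> (w lambda S / z) X *)
Definition mul_wSz (X : series3) : series3 := fun i j l =>
  shift P (X (i + 1) (j - 1) (l - 1)).
(* X |-> delta_+(w lambda S / z) X *)
Definition mul_delta (X : series3) : series3 := fun i j l =>
  \sum_(k \in [set: nat]) iter k mul_wSz X i j l.

Definition adler3_rhs : series3 :=
  sub3
    (mul_LwS (mul_Lz (mul_delta
       (sub3 (mul_Ladj one3) (mul_wSz (mul_Lw one3))))))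
    (sub3
       (mul_Lz (mul_delta (mul_Lw (mul_Ladj one3))))
       (mul_LwS (mul_wSz (mul_delta (mul_Lw (mul_Ladj one3)))))).

Definition adler3 : Prop :=
  forall i j l, bracket P (L i) (L j) l = adler3_rhs i j l.

(* Since h_0 = 0, the flow of h_0 is trivial, whereas [L_+, L] need not vanish
   (take x^3 = 0 <> x^2, S(x) = - x, L = x + x S^-1 and the zero bracket):
   the Lax form of the flows starts at n = 1. *)
Definition hamiltonian (n : nat) : V :=
  if n == 0%N then 0 else - (n%:R^-1 : F) *: mres (pd_exp L n).

End Definitions.

Section Representatives.
Variables (F : fieldType) (V : comAlgType F) (P : mPVA V).

Lemma bracket1E a b (A : set int) : finite_set A ->
  (forall n, ~ A n -> bracket P a b n = 0) ->
  bracket1 P a b = \sum_(n <- fset_set A) bracket P a b n.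
Proof.
move=> finA A0; rewrite -fsbig_finite // /bracket1.
by apply/esym/fsbig_widen => // n [_ /A0].
Qed.

Lemma bracket1D a b a' b' a'' b'' :
  (forall n, bracket P a b n = bracket P a' b' n + bracket P a'' b'' n) ->
  bracket1 P a b = bracket1 P a' b' + bracket1 P a'' b''.
Proof.
move=> E.
pose A := [set n | bracket P a' b' n != 0] `|` [set n | bracket P a'' b'' n != 0].
have finA : finite_set A by rewrite finite_setU; split; exact: bracket_finite.
have A1 n : ~ A n -> bracket P a' b' n = 0.
  by move=> /not_orP[+ _] => /negP/negPn/eqP.
have A2 n : ~ A n -> bracket P a'' b'' n = 0.
  by move=> /not_orP[_] /negP/negPn/eqP.
rewrite !(@bracket1E _ _ A) //; last by move=> n nA; rewrite E A1 // A2 // addr0.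
by rewrite -big_split; apply: eq_bigr => n _; rewrite E.
Qed.

Lemma bracket1Dl a a' b :
  bracket1 P (a + a') b = bracket1 P a b + bracket1 P a' b.
Proof.
by apply: bracket1D => n; rewrite -[a in LHS]scale1r bracket_linearl scale1r.
Qed.

Lemma bracket1Dr a b b' :
  bracket1 P a (b + b') = bracket1 P a b + bracket1 P a b'.
Proof.
by apply: bracket1D => n; rewrite -[b in LHS]scale1r bracket_linearr scale1r.
Qed.

Lemma bracket1_shiftl a b : bracket1 P (shift P a) b = bracket1 P a b.
Proof.
rewrite [RHS](reindex_fsbigT (fun n : int => n + 1)).
  by apply: eq_fsbigr => n _; rewrite bracket_shiftl.
by exists (fun n => n - 1) => n; rewrite ?addrK ?subrK.
Qed.

Lemma bracket1_shiftr a b :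
  bracket1 P a (shift P b) = shift P (bracket1 P a b).
Proof.
have finA := bracket_finite P a b.
have -> : bracket1 P a b = \sum_(n <- fset_set [set n | bracket P a b n != 0]) bracket P a b n.
  by apply: bracket1E => // n /negP/negPn/eqP.
rewrite raddf_sum -fsbig_finite //.
rewrite [LHS](reindex_fsbigT (fun n : int => n + 1)).
  rewrite [RHS](fsbig_widen _ [set: int]) //.
    by apply: eq_fsbigr => n _; rewrite bracket_shiftr addrK.
  move=> n [_ nz] /=; have /negP/negPn/eqP -> := nz; exact: raddf0.
by exists (fun n => n - 1) => n; rewrite ?addrK ?subrK.
Qed.

Lemma repr_intf a :
  exists c, repr (intf P a : Quotient.quot (total_difference P)) = a + (shift P c - c).
Proof.
set r := repr _.
have : r - a \in total_difference P.
  by rewrite Quotient.idealrBE /r reprK.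
by case/asboolP => c Ec; exists c; rewrite -Ec addrC subrK.
Qed.

Lemma actE a b : act (intf P a) b = bracket1 P a b.
Proof.
rewrite /act; have [c ->] := repr_intf a.
have := bracket1Dl (shift P c - c) c b.
rewrite subrK bracket1_shiftl bracket1Dl => /eqP.
by rewrite -subr_eq subrr => /eqP <-; rewrite addr0.
Qed.

Lemma lieE a b : lie (intf P a) (intf P b) = intf P (bracket1 P a b).
Proof.
rewrite /lie actE; have [c ->] := repr_intf b.
have := bracket1Dr a (shift P c - c) c.
rewrite subrK bracket1_shiftr bracket1Dr => /eqP.
rewrite -subr_eq => /eqP <-; apply/eqP; rewrite -Quotient.idealrBE addrC addKr.
by apply/asboolP; exists (bracket1 P a c).
Qed.

End Representatives.

(* Main.v *)
(* For Laurent operators A, B put Phi(A, B) = sum_i {A_i_{lambda S} c}_->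
   S^i(B_{-i}) at lambda = 1, the part of {int mRes(A B), c} in which only A is
   varied.  The left Leibniz rule gives Phi(A B, C) = Phi(A, B C) + Phi(B, C A),
   whence {int mRes L^n, c} = n Phi(L, L^(n-1)).  For c = L_j the 3-Adler identity
   turns Phi(L, M), with M = L^(n-1), into the j-th coefficient of
     L (L M L)_+ - L (L M)_{>0} L + L (M L)_{>0} L - (L M L)_+ L,
   in which the middle terms cancel as L M = M L: this is the Lax equation.
   Since {int h_m, -} is a derivation commuting with S, it sends L^n to
   [(L^(m+1))_+, L^n], and mRes of a commutator lies in (S - 1) V; this is the
   involution, and compatibility follows by the Jacobi identity at
   lambda = mu = 1. *)
From HB Require Import structures.
Require Import Defs.
From mathcomp Require Import all_boot all_order all_algebra.
From mathcomp Require Import finmap generic_quotient boolp classical_sets.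
From mathcomp Require Import functions cardinality fsbigop ring zify.

Set Implicit Arguments.
Unset Strict Implicit.
Unset Printing Implicit Defensive.

Import GRing.Theory.
Local Open Scope ring_scope.

Local Notation "\sumz_ i F" := (\sum_(i \in [set: int]%classic) F)
  (at level 41, i name, F at level 41, right associativity).

(** * Finitely supported sums over the integers, in one, two and three indices *)

Section FiniteSums.
Variable V : zmodType.
Implicit Types (F G : int -> V).

(** Finiteness is stated as an explicit bound on absolute values, so that supports can be bounded by
    linear arithmetic and several sums can be taken over one common segment. *)
Definition fin_supp1 F := exists K : nat, forall i, F i != 0 -> (`|i| <= K)%N.
Definition fin_supp2 (F : int -> int -> V) :=
  exists K : nat, forall i j, F i j != 0 -> (`|i| <= K)%N /\ (`|j| <= K)%N.
Definition fin_supp3 (F : int -> int -> int -> V) :=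
  exists K : nat, forall i j k, F i j k != 0 ->
    [/\ (`|i| <= K)%N, (`|j| <= K)%N & (`|k| <= K)%N].

Definition segment (K : nat) : seq int := [seq i%:Z - K%:Z | i <- iota 0 K.*2.+1].

Lemma mem_segment K i : (i \in segment K) = (`|i| <= K)%N.
Proof.
apply/mapP/idP => [[k]|iK]; first by rewrite mem_iota => kK ->; lia.
by exists (absz (i + K%:Z)); rewrite ?mem_iota; lia.
Qed.

Lemma segment_uniq K : uniq (segment K).
Proof. by rewrite map_inj_uniq ?iota_uniq// => i j; lia. Qed.

Lemma fsum_segment F (K : nat) : (forall i, F i != 0 -> (`|i| <= K)%N) ->
  \sumz_i F i = \sum_(i <- segment K) F i.
Proof.
move=> FK; rewrite [RHS]fsbig_seq ?segment_uniq//; apply/esym/fsbig_widen => //.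
move=> i [_ /=]; rewrite mem_segment => iK.
by apply/eqP/negPn/negP => /FK.
Qed.

Lemma fin_supp1_finite F : finite_set [set i | F i != 0]%classic -> fin_supp1 F.
Proof.
move=> finF; set A := [set i | F i != 0]%classic in finF *.
(* The sum of all [|i|] over the support dominates each of them. *)
exists (\sum_(i <- fset_set A) `|i|%N)%N => i Fi.
by rewrite (big_rem i) ?leq_addr//= in_fset_set// inE.
Qed.

Lemma eq_fsum F G : F =1 G -> \sumz_i F i = \sumz_i G i.
Proof. by move=> FG; apply: eq_fsbigr => i _; exact: FG. Qed.

Lemma fsum0 F : (forall i, F i = 0) -> \sumz_i F i = 0.
Proof. by move=> F0; apply: fsbig1. Qed.

Lemma fsum_single (i : int) F : (forall k, k != i -> F k = 0) -> \sumz_k F k = F i.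
Proof.
move=> Fi; rewrite -[RHS](fsbig_set1 +%R i F).
by apply/esym/fsbig_widen => // k [_ /eqP ki]; exact: Fi.
Qed.

Lemma fsumD F G : fin_supp1 F -> fin_supp1 G ->
  \sumz_i (F i + G i) = \sumz_i F i + \sumz_i G i.
Proof.
move=> [K FK] [M GM].
have leK i : F i != 0 -> (`|i| <= K + M)%N by move=> /FK; lia.
have leM i : G i != 0 -> (`|i| <= K + M)%N by move=> /GM; lia.
rewrite !(fsum_segment (K := K + M))// ?big_split// => i FG.
have [F0|/leK//] := eqVneq (F i) 0; apply: leM.
by apply: contra_neq FG => ->; rewrite F0 addr0.
Qed.

Lemma fsum_morph (W : zmodType) (f : V -> W) F : {morph f : x y / x + y} ->
  fin_supp1 F -> f (\sumz_i F i) = \sumz_i f (F i).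
Proof.
move=> fD [K FK]; have f0 : f 0 = 0.
  by apply: (addrI (f 0)); rewrite -fD !addr0.
rewrite (fsum_segment FK) (big_morph f fD f0) [LHS]fsbig_seq ?segment_uniq//.
apply: fsbig_widen => // i [_ /=]; rewrite mem_segment => iK.
by have [->//|/FK] := eqVneq (F i) 0.
Qed.

(** No finiteness is assumed: [F] and [- F] have the same support, and when it is infinite both sums
    take the default value 0. *)
Lemma fsumN F : \sumz_i - F i = - \sumz_i F i.
Proof.
have [[K FK]|infF] := pselect (fin_supp1 F).
  by rewrite -(fsum_morph (f := -%R)) //; [exact: opprD | exists K].
rewrite !fsbig_dflt ?oppr0// => finF; apply: infF; apply: fin_supp1_finite;
  apply: sub_finite_set finF => i /= /eqP; first by move=> ?; split.
by move=> Fi; split => //= /eqP; rewrite oppr_eq0 => /eqP.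
Qed.

Lemma fsum_shift (k : int) F : \sumz_i F i = \sumz_i F (i + k).
Proof.
apply: reindex_fsbigT; exists (fun i => i - k) => i; first exact: addrK.
exact: subrK.
Qed.

Lemma fsum_reflect (k : int) F : \sumz_i F i = \sumz_i F (k - i).
Proof. by apply: reindex_fsbigT; exists (fun i => k - i) => i; lia. Qed.

Lemma fin_supp2r (F : int -> int -> V) i : fin_supp2 F -> fin_supp1 (F i).
Proof. by move=> [K FK]; exists K => j /FK[]. Qed.

Lemma fin_supp2C (F : int -> int -> V) :
  fin_supp2 F -> fin_supp2 (fun j i => F i j).
Proof. by move=> [K FK]; exists K => j i /FK[]. Qed.

Lemma fin_supp3r (F : int -> int -> int -> V) i : fin_supp3 F -> fin_supp2 (F i).
Proof. by move=> [K FK]; exists K => j k /FK[]. Qed.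

Lemma fin_supp2_fsum (F : int -> int -> V) :
  fin_supp2 F -> fin_supp1 (fun i => \sumz_j F i j).
Proof.
move=> [K FK]; exists K => i; apply: contraNT => iK; apply/eqP/fsum0 => j.
by apply/eqP; apply: contraNT iK => /FK[].
Qed.

Lemma fin_supp3_fsum (F : int -> int -> int -> V) :
  fin_supp3 F -> fin_supp2 (fun i j => \sumz_k F i j k).
Proof.
move=> [K FK]; exists K => i j F0; apply/andP.
apply: contraNT F0 => ijK; apply/eqP/fsum0 => k.
by apply/eqP; apply: contraNT ijK => /FK[-> ->].
Qed.

Lemma fsum_exchange (F : int -> int -> V) : fin_supp2 F ->
  \sumz_i \sumz_j F i j = \sumz_j \sumz_i F i j.
Proof.
move=> finF; have [K FK] := finF.
have row i : \sumz_j F i j = \sum_(j <- segment K) F i j.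
  by apply: fsum_segment => j /FK[].
have col j : \sumz_i F i j = \sum_(i <- segment K) F i j.
  by apply: fsum_segment => i /FK[].
rewrite (eq_fsum row) (eq_fsum col).
rewrite (fsum_segment (K := K)); last first.
  move=> i; rewrite -row; apply: contraNT => iK; apply/eqP/fsum0 => j.
  by apply/eqP; apply: contraNT iK => /FK[].
rewrite (fsum_segment (K := K)); first exact: exchange_big.
move=> j; rewrite -col; apply: contraNT => jK; apply/eqP/fsum0 => i.
by apply/eqP; apply: contraNT jK => /FK[].
Qed.

Lemma fsum_exchange12 (F : int -> int -> int -> V) : fin_supp3 F ->
  \sumz_i \sumz_j \sumz_k F i j k = \sumz_j \sumz_i \sumz_k F i j k.
Proof. by move=> /fin_supp3_fsum /fsum_exchange. Qed.

Lemma fsum_exchange23 (F : int -> int -> int -> V) : fin_supp3 F ->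
  \sumz_i \sumz_j \sumz_k F i j k = \sumz_i \sumz_k \sumz_j F i j k.
Proof. by move=> finF; apply: eq_fsum => i; apply/fsum_exchange/fin_supp3r. Qed.

Lemma fin_supp1B F G : fin_supp1 F -> fin_supp1 G -> fin_supp1 (fun i => F i - G i).
Proof.
move=> [K FK] [M GM]; exists (K + M)%N => i FG.
have [F0|/FK] := eqVneq (F i) 0; last lia.
suff /GM : G i != 0 by lia.
by apply: contra_neq FG => ->; rewrite F0 subrr.
Qed.

(** Only finitely many rows are nonzero, so the bounds of the single rows add up to a uniform one.
    This suits iterated brackets, whose support is known one bracket at a time. *)
Lemma fin_supp2_rows (F : int -> int -> V) (K : nat) :
  (forall i j, F i j != 0 -> (`|i| <= K)%N) -> (forall i, fin_supp1 (F i)) ->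
  fin_supp2 F.
Proof.
move=> FK /choice[M FM]; exists (K + \sum_(i <- segment K) M i)%N => i j Fij.
have iK := FK _ _ Fij; split; first exact: leq_trans iK (leq_addr _ _).
have := FM _ _ Fij => /leq_trans -> //.
by rewrite (big_rem i) ?mem_segment//= addnCA leq_addr.
Qed.

Lemma fin_supp2B (F G : int -> int -> V) :
  fin_supp2 F -> fin_supp2 G -> fin_supp2 (fun i j => F i j - G i j).
Proof.
move=> [K FK] [M GM]; exists (K + M)%N => i j FG.
have [F0|/FK] := eqVneq (F i j) 0; last lia.
suff /GM : G i j != 0 by lia.
by apply: contra_neq FG => ->; rewrite F0 subrr.
Qed.

Lemma fsumB F G : fin_supp1 F -> fin_supp1 G ->
  \sumz_i (F i - G i) = \sumz_i F i - \sumz_i G i.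
Proof.
move=> finF [K GK]; rewrite fsumD//; first by rewrite fsumN.
by exists K => i; rewrite oppr_eq0 => /GK.
Qed.

Lemma fsum2B (F G : int -> int -> V) : fin_supp2 F -> fin_supp2 G ->
  \sumz_i \sumz_j (F i j - G i j) = \sumz_i \sumz_j F i j - \sumz_i \sumz_j G i j.
Proof.
move=> finF finG; rewrite -fsumB; try exact: fin_supp2_fsum.
by apply: eq_fsum => i; rewrite fsumB//; exact: fin_supp2r.
Qed.

Lemma fin_supp3C12 (F : int -> int -> int -> V) :
  fin_supp3 F -> fin_supp3 (fun j i k => F i j k).
Proof. by move=> [K FK]; exists K => j i k /FK[]. Qed.

Lemma fin_supp3C23 (F : int -> int -> int -> V) :
  fin_supp3 F -> fin_supp3 (fun i k j => F i j k).
Proof. by move=> [K FK]; exists K => i k j /FK[]. Qed.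

Lemma fsum_rotate (F : int -> int -> int -> V) : fin_supp3 F ->
  \sumz_i \sumz_j \sumz_k F i j k = \sumz_k \sumz_i \sumz_j F i j k.
Proof.
by move=> finF; rewrite fsum_exchange23// fsum_exchange12//; exact: fin_supp3C23.
Qed.

End FiniteSums.

Lemma neq0_mul (R : pzRingType) (x y : R) : x * y != 0 -> x != 0 /\ y != 0.
Proof.
by split; [move: H | move: H]; apply: contra_neq => ->; rewrite ?mul0r ?mulr0.
Qed.

Lemma neq0_mulrb (V : zmodType) (x : V) (b : bool) : x *+ b != 0 -> x != 0.
Proof. by case: b => //; rewrite eqxx. Qed.

(** The sign by which a bound above on exponents, as in V((S^-1)), and a bound below, as in V((S)),
    become the same inequality. *)
Definition signed (e : bool) (n : int) : int := if e then n else - n.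

(** Splits a nonzero product into nonzero factors, strips indicators and powers of S, and replaces
    each nonvanishing coefficient by the bound that it puts on its index; linear arithmetic can then
    finish. *)
Ltac bound_indices :=
  repeat match goal with
  | H : is_true (_ * _ != 0) |- _ =>
      let H1 := fresh in let H2 := fresh in case/neq0_mul: H => H1 H2
  | H : is_true (_ *+ nat_of_bool _ != 0) |- _ => move/neq0_mulrb: H => H
  | H : is_true (shiftz _ _ _ != 0) |- _ => move/shiftz_neq0: H => H
  | H : is_true (?A ?n != 0), B : forall m, is_true (?A m != 0) -> _ |- _ =>
      move/B: H => H
  end.

(** * Integer powers of S and the algebra of Laurent difference operators *)

Section Operators.
Variables (F : fieldType) (V : comAlgType F) (P : mPVA V).
Implicit Types (A B C : pseudodiff V) (e : bool).
Local Notation S := (shiftz P).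
Local Notation "x *? b" := (x *+ nat_of_bool b%R) (at level 40, left associativity).
Local Notation "A ∘ B" := (pd_mul P A B) (at level 40, left associativity).

Lemma shiftz0 x : S 0 x = x. Proof. by []. Qed.

Lemma shiftz1 x : S 1 x = shift P x. Proof. by []. Qed.

Lemma shiftzS n x : S (n + 1) x = shift P (S n x).
Proof.
case: n => [n|[|n]]; first by rewrite -PoszD addn1.
  by rewrite /shiftz /= shift_invK.
have -> : Negz n.+1 + 1 = Negz n by lia.
by rewrite {2}/shiftz /= shift_invK.
Qed.

Lemma shiftzD m n x : S (m + n) x = S m (S n x).
Proof.
have Snat (k : nat) (i : int) y : S (k%:Z + i) y = S k (S i y).
  elim: k i => [|k IHk] i; first by rewrite add0r.
  have -> : k.+1%:Z + i = k%:Z + i + 1 by lia.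
  by rewrite shiftzS IHk -shiftzS -PoszD addn1.
have Sinj (k : nat) : injective (S k%:Z).
  elim: k => [|k IHk] y z //; rewrite -addn1 PoszD !shiftzS.
  by move=> /(can_inj (shiftK P)) /IHk.
case: m => k; first exact: Snat.
(* For a negative [m], applying the injective map S^(k+1) to both sides leaves only additions of
   nonnegative powers. *)
by apply: (Sinj k.+1); rewrite -!Snat NegzE addrA addrN add0r.
Qed.

Lemma shiftzK n : cancel (S n) (S (- n)).
Proof. by move=> x; rewrite -shiftzD addNr. Qed.

Lemma shiftz_ind (Q : (V -> V) -> Prop) : Q id ->
  (forall f, Q f -> Q (shift P \o f)) -> (forall f, Q f -> Q (shift_inv P \o f)) ->
  forall n, Q (S n).
Proof.
move=> Q0 Qf Qg [k|k]; rewrite /shiftz/=; first by elim: k => //= k; apply: Qf.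
by elim: k => [|k] /=; [apply: (Qg id) | apply: Qg].
Qed.

Lemma shift_invB x y : shift_inv P (x - y) = shift_inv P x - shift_inv P y.
Proof. by apply: (can_inj (shiftK P)); rewrite raddfB/= !shift_invK. Qed.

Lemma shift_invM x y : shift_inv P (x * y) = shift_inv P x * shift_inv P y.
Proof. by apply: (can_inj (shiftK P)); rewrite rmorphM/= !shift_invK. Qed.

Lemma shift_inv1 : shift_inv P 1 = 1.
Proof. by apply: (can_inj (shiftK P)); rewrite rmorph1/= !shift_invK. Qed.

Lemma shiftz_zmod_morphism n : zmod_morphism (S n).
Proof.
apply: (@shiftz_ind (fun f => zmod_morphism f)) => // {n} f fB x y /=; rewrite fB.
  exact: raddfB.
exact: shift_invB.
Qed.

Lemma shiftz_monoid_morphism n : monoid_morphism (S n).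
Proof.
apply: (@shiftz_ind (fun f => monoid_morphism f)) => // {n} f [f1 fM];
  split=> [|x y] /=.
- by rewrite f1 rmorph1.
- by rewrite fM rmorphM.
- by rewrite f1 shift_inv1.
- by rewrite fM shift_invM.
Qed.

HB.instance Definition _ n :=
  GRing.isZmodMorphism.Build V V (S n) (shiftz_zmod_morphism n).
HB.instance Definition _ n :=
  GRing.isMonoidMorphism.Build V V (S n) (shiftz_monoid_morphism n).

Lemma shiftz_neq0 n x : S n x != 0 -> x != 0.
Proof. by apply: contra_neq => ->; rewrite raddf0. Qed.

(* [laurent true] and [laurent false] are V((S^-1)) and V((S)): the two cases
   differ only in the finiteness of the sums. *)
Definition laurent e A :=
  exists N : nat, forall n, A n != 0 -> signed e n <= N%:Z.

Lemma laurent_either A : laurent_Sinv A \/ laurent_S A -> exists e, laurent e A.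
Proof.
case=> -[N AN]; [exists true | exists false]; exists `|N|%N => n;
  by apply: contraNT => nN; rewrite /signed in nN; apply/eqP/AN; lia.
Qed.

Lemma laurent_sub e A B : (forall n, B n != 0 -> A n != 0) ->
  laurent e A -> laurent e B.
Proof. by move=> BA [N AN]; exists N => n /BA/AN. Qed.

(** [A] bounds [i] on one side; [B] bounds [n - i] on that same side, hence [i] on the other. *)
Lemma pd_mul_fin e A B n : laurent e A -> laurent e B ->
  fin_supp1 (fun i => A i * S i (B (n - i))).
Proof.
move=> [N AN] [M BM]; exists (`|n| + N + M)%N => i ABi.
bound_indices; destruct e; simpl in *; lia.
Qed.

Lemma laurent_mul e A B : laurent e A -> laurent e B -> laurent e (A ∘ B).
Proof.
move=> [N AN] [M BM]; exists (N + M)%N => n; apply: contraNT => nNM.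
apply/eqP/fsum0 => i; apply/eqP; apply: contraNT nNM => ABi.
by bound_indices; destruct e; simpl in *; lia.
Qed.

Lemma laurent_one e : laurent e (pd_one V).
Proof.
exists 0%N => n; rewrite /pd_one; case: (eqVneq n) => [->|_ /eqP//].
by case: e; rewrite ?oppr0.
Qed.

Lemma laurent_exp e A n : laurent e A -> laurent e (pd_exp P A n).
Proof.
move=> lA; elim: n => [|n]; [exact: laurent_one | exact: laurent_mul].
Qed.

(** Both products expand into one double sum, over the exponent [a] taken from [A] and the total
    exponent [l] taken from [A] and [B]. The three exponents are bounded on the same side and add up
    to [m], so the support is finite and the sums may be exchanged. *)
Lemma pd_mulA e A B C : laurent e A -> laurent e B -> laurent e C ->
  A ∘ (B ∘ C) = A ∘ B ∘ C.
Proof.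
move=> lA lB lC; apply: funext => m.
have finABC : fin_supp2 (fun a l => A a * S a (B (l - a)) * S l (C (m - l))).
  case: lA lB lC => [N AN] [M BM] [R CR]; exists (`|m| + N + M + R)%N => a l ABC.
  by bound_indices; destruct e; simpl in *; lia.
transitivity (\sumz_a \sumz_l (A a * S a (B (l - a)) * S l (C (m - l)))).
  apply: eq_fsum => a.
  rewrite (fsum_morph (raddfD (S a))); last exact: (pd_mul_fin _ lB lC).
  rewrite (fsum_morph (mulrDr (A a))); last first.
    have [K BK] := pd_mul_fin (m - a) lB lC; exists K => i /=.
    by move=> /shiftz_neq0 /BK.
  rewrite [LHS](fsum_shift (- a)); apply: eq_fsum => l.
  rewrite /= rmorphM /= mulrA -shiftzD; congr (_ * S _ _ * S _ (C _)); lia.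
rewrite (fsum_exchange finABC); apply: eq_fsum => l.
rewrite (fsum_morph (f := *%R^~ _)) //; first by move=> x y; rewrite mulrDl.
exact: (pd_mul_fin _ lA lB).
Qed.

Lemma pd_mul1r A : pd_one V ∘ A = A.
Proof.
apply: funext => n; rewrite [LHS](@fsum_single _ 0) => [|k /negPf k0].
  by rewrite /pd_one mul1r subr0.
by rewrite /pd_one k0 mul0r.
Qed.

Lemma pd_mulr1 A : A ∘ pd_one V = A.
Proof.
apply: funext => n; rewrite [LHS](@fsum_single _ n) => [|k].
  by rewrite /pd_one subrr rmorph1 mulr1.
by rewrite eq_sym -subr_eq0 /pd_one => /negPf ->; rewrite raddf0 mulr0.
Qed.

Lemma pd_expD e A m n : laurent e A ->
  pd_exp P A (m + n) = pd_exp P A m ∘ pd_exp P A n.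
Proof.
move=> lA; elim: m => [|m IHm]; first by rewrite pd_mul1r.
transitivity (A ∘ (pd_exp P A m ∘ pd_exp P A n)); first by rewrite -IHm.
by rewrite (pd_mulA (e := e)) //; apply: laurent_exp.
Qed.

Lemma pd_exp1 A : pd_exp P A 1 = A.
Proof. exact: pd_mulr1. Qed.

(** * The bracket in its first argument, and the variation of residues of powers *)

Lemma bracketDl a b c n : bracket P (a + b) c n = bracket P a c n + bracket P b c n.
Proof. by rewrite -[a in LHS]scale1r bracket_linearl scale1r. Qed.

Lemma bracket0l c n : bracket P 0 c n = 0.
Proof. by apply: (addrI (bracket P 0 c n)); rewrite -bracketDl !addr0. Qed.

(** Skew-symmetry carries the right Leibniz rule over to the first argument; the power S^n it
    involves lands on the factor that is not bracketed. *)
Lemma bracket_leibnizl a b c n :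
  bracket P (a * b) c n = bracket P a c n * S n b + bracket P b c n * S n a.
Proof.
have skew x : bracket P x c n = - S n (bracket P c x (- n)).
  exact: bracket_skew.
by rewrite !skew bracket_leibniz raddfD /= !rmorphM opprD !mulNr.
Qed.

Lemma bracket_shiftzl k a c n : bracket P (S k a) c n = bracket P a c (n + k).
Proof.
have Snat (i : nat) b m : bracket P (S i%:Z b) c m = bracket P b c (m + i%:Z).
  elim: i m => [|i IHi] m; first by rewrite addr0.
  by rewrite -addn1 PoszD shiftzS bracket_shiftl IHi; congr (bracket P b c _); lia.
case: k => k; first exact: Snat.
rewrite -[a in RHS](shiftzK (Negz k)) NegzE opprK Snat.
by congr (bracket P _ c _); lia.
Qed.

(* The value of [{a_{lambda S} c}_-> x] at [lambda = 1]. *)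
Definition pairing (c a x : V) : V := \sumz_n (bracket P a c n * S n x).

Lemma pairing_fin c a x : fin_supp1 (fun n => bracket P a c n * S n x).
Proof.
have [K aK] := fin_supp1_finite (bracket_finite P a c).
by exists K => n /neq0_mul[/aK].
Qed.

Lemma pairing1 c a : pairing c a 1 = bracket1 P a c.
Proof. by apply: eq_fsum => n; rewrite rmorph1 mulr1. Qed.

Lemma pairingDl c x : {morph (pairing c)^~ x : a b / a + b}.
Proof.
move=> a b; rewrite -fsumD; try exact: pairing_fin.
by apply: eq_fsum => n; rewrite bracketDl mulrDl.
Qed.

Lemma pairingDr c a : {morph pairing c a : x y / x + y}.
Proof.
move=> x y; rewrite -fsumD; try exact: pairing_fin.
by apply: eq_fsum => n; rewrite raddfD mulrDr.
Qed.

Lemma pairing_neq0 c a x : pairing c a x != 0 -> a != 0 /\ x != 0.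
Proof.
by split; move: H; apply: contra_neq => ->; apply: fsum0 => n;
  rewrite ?bracket0l ?mul0r ?raddf0 ?mulr0.
Qed.

Lemma pairingM c a b x :
  pairing c (a * b) x = pairing c a (b * x) + pairing c b (a * x).
Proof.
rewrite -fsumD; try exact: pairing_fin.
apply: eq_fsum => n; rewrite bracket_leibnizl !rmorphM; ring.
Qed.

(** Sesquilinearity only translates the power of lambda, and at lambda = 1 a translation is absorbed
    by reindexing. *)
Lemma pairing_shiftz c k a x : pairing c (S k a) x = pairing c a (S (- k) x).
Proof.
rewrite [RHS](fsum_shift k); apply: eq_fsum => n.
by rewrite bracket_shiftzl -shiftzD addrK.
Qed.

(* [variation c A B] is Phi(A, B). *)
Definition variation (c : V) A B : V := \sumz_i pairing c (A i) (S i (B (- i))).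

(** The left Leibniz rule varies either the coefficient of [A] or that of [B]. In the second case
    [pairing_shiftz] takes S^a off the coefficient of [B], which rotates the product cyclically. *)
Lemma variation_mul e c A B C : laurent e A -> laurent e B -> laurent e C ->
  variation c (A ∘ B) C = variation c A (B ∘ C) + variation c B (C ∘ A).
Proof.
move=> lA lB lC.
(* [T1] and [T2] vary [A] and [B] respectively in the term of [A ∘ B] where [A] has exponent [a] and
   the product has exponent [i]. *)
pose T1 i a := pairing c (A a) (S a (B (i - a)) * S i (C (- i))).
pose T2 i a := pairing c (B (i - a)) (S (- a) (A a) * S (i - a) (C (- i))).
have fin1 : fin_supp2 T1.
  case: lA lB lC => [N AN] [M BM] [R CR]; exists (N + M + R)%N => i a.
  move=> /pairing_neq0[h1 h2].
  by bound_indices; destruct e; simpl in *; lia.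
have fin2 : fin_supp2 T2.
  case: lA lB lC => [N AN] [M BM] [R CR]; exists (N + M + R)%N => i a.
  move=> /pairing_neq0[h1 h2].
  by bound_indices; destruct e; simpl in *; lia.
transitivity (\sumz_i (\sumz_a T1 i a + \sumz_a T2 i a)).
  apply: eq_fsum => i.
  rewrite [LHS](fsum_morph (pairingDl c _)); last exact: (pd_mul_fin _ lA lB).
  rewrite -fsumD; try exact: fin_supp2r.
  apply: eq_fsum => a; rewrite pairingM pairing_shiftz.
  by rewrite rmorphM /= -shiftzD [- a + i]addrC.
rewrite fsumD; try exact: fin_supp2_fsum.
congr (_ + _).
  rewrite fsum_exchange//; apply: eq_fsum => a.
  rewrite (fsum_morph (raddfD (S a))); last exact: (pd_mul_fin _ lB lC).
  rewrite (fsum_morph (pairingDr c (A a))); last first.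
    have [K BK] := pd_mul_fin (- a) lB lC; exists K => i.
    by move=> /shiftz_neq0 /BK.
  rewrite [LHS](fsum_shift a); apply: eq_fsum => b.
  rewrite /= rmorphM /= -shiftzD /T1 addrK [a + b]addrC.
  by congr (pairing _ _ (_ * S _ (C _))); lia.
(* The substitution [a = i - b] makes [b] the exponent of the varied coefficient of [B]. *)
transitivity (\sumz_i \sumz_b T2 i (i - b)).
  by apply: eq_fsum => i; exact: fsum_reflect.
rewrite fsum_exchange; last first.
  case: fin2 => K TK; exists (K + K)%N => i b /TK; lia.
apply: eq_fsum => b.
rewrite (fsum_morph (raddfD (S b))); last exact: (pd_mul_fin _ lC lA).
rewrite (fsum_morph (pairingDr c (B b))); last first.
  have [K BK] := pd_mul_fin (- b) lC lA; exists K => i.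
  by move=> /shiftz_neq0 /BK.
rewrite [LHS](fsum_reflect 0); apply: eq_fsum => d.
rewrite /= rmorphM /= -shiftzD /T2 mulrC.
congr (pairing _ (B _) (S _ (C _) * S _ (A _))); lia.
Qed.

(** The Leibniz rule for 1 * 1 = 1 makes the pairing with first entry 1 equal to twice itself, hence
    zero. *)
Lemma variation_one_l c A : variation c (pd_one V) A = 0.
Proof.
apply: fsum0 => i; rewrite /pd_one; case: eqVneq => [->|_].
  have /eqP := pairingM c 1 1 (S 0 (A (- 0))).
  by rewrite !mul1r -subr_eq0 opprD addrA subrr sub0r oppr_eq0 => /eqP.
by apply: fsum0 => n; rewrite bracket0l mul0r.
Qed.

Lemma variation_one_r c A : variation c A (pd_one V) = bracket1 P (mres A) c.
Proof.
rewrite [LHS](@fsum_single _ 0) => [|i /negPf i0].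
  by rewrite /pd_one oppr0 eqxx rmorph1 pairing1.
by rewrite /pd_one oppr_eq0 i0 raddf0; apply: fsum0 => n; rewrite raddf0 mulr0.
Qed.

Lemma bracket1_mres_exp e c A n : laurent e A ->
  bracket1 P (mres (pd_exp P A n.+1)) c = variation c A (pd_exp P A n) *+ n.+1.
Proof.
move=> lA.
(* Each application of [variation_mul] splits off one factor [A] and sends it to the second
   operator, so [k] must vary in the induction. The truncated predecessor at [m = k = 0] is
   harmless, since the multiplicity is then 0. *)
have var_exp m k : variation c (pd_exp P A m) (pd_exp P A k)
    = variation c A (pd_exp P A (m + k).-1) *+ m.
  elim: m k => [|m IHm] k; first by rewrite variation_one_l.
  rewrite (@variation_mul e)//; try exact: laurent_exp.
  rewrite -/(pd_exp P A m) -(pd_expD m k lA).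
  have -> : pd_exp P A k ∘ A = pd_exp P A (k + 1) by rewrite (pd_expD k 1 lA) pd_exp1.
  rewrite IHm.
  by rewrite addn1 addnS mulrS.
by rewrite -variation_one_r (var_exp n.+1 0%N) addn0.
Qed.



(** * Coefficients of the right-hand side of the 3-Adler identity *)

Variables (e : bool) (L : pseudodiff V) (lL : laurent e L).

(** Extending by zero to negative indices gives the sum in delta_+ the form needed for the
    reindexing rules over the integers. *)
Lemma fsum_nat (W : zmodType) (f : nat -> W) :
  \sum_(k \in [set: nat]%classic) f k = \sumz_k (f (absz k) *? (0 <= k)).
Proof.
rewrite [LHS](_ : _ = \sum_(k \in range Posz) (f (absz k) *? (0 <= k))).
  apply: fsbig_widen => // -[k|k] [_ /=]; first by case; exists k.
  by move=> _; rewrite mulr0n.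
by rewrite fsbig_image //; apply: in2W => i j [].
Qed.

Lemma fin_supp1_single (W : zmodType) (G : int -> W) (i : int) :
  (forall k, k != i -> G k = 0) -> fin_supp1 G.
Proof.
by move=> Gi; exists `|i|%N => k; case: (eqVneq k i) => [->|/Gi -> /eqP].
Qed.

Lemma mul_delta_fsum (X : series3 V) i j l :
  mul_delta P X i j l = \sumz_k (S k (X (i + k) (j - k) (l - k)) *? (0 <= k)).
Proof.
have iterE k : iter k (mul_wSz P) X i j l =
    S k%:Z (X (i + k%:Z) (j - k%:Z) (l - k%:Z)).
  elim: k i j l => [|k IHk] i j l /=; first by rewrite addr0 !subr0.
  rewrite /mul_wSz IHk -shiftzS -PoszD addn1.
  by congr (S _ (X _ _ _)); lia.
rewrite /mul_delta fsum_nat; apply: eq_fsum => -[k|k] //=; first by rewrite iterE.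
Qed.

Lemma mul_Ladj_one3 i j l :
  mul_Ladj P L (one3 V) i j l = S l (L (- l)) *? ((i + l == 0) && (j == 0)).
Proof.
rewrite [LHS](@fsum_single _ i) => [|k ki].
  rewrite /one3 subrr eqxx andTb andbC [l + i]addrC.
  case: eqP => [il|_]; last by rewrite mulr0.
  have -> : l = - i by lia.
  rewrite opprK /=; by case: (j == 0); rewrite ?mulr1 ?mulr0.
rewrite /one3 (_ : (i - k == 0) = false) ?mulr0//; lia.
Qed.

Lemma adler3_left i j l :
  mul_LwS P L (mul_Lz L (mul_delta P
    (sub3 (mul_Ladj P L (one3 V)) (mul_wSz P (mul_Lw L (one3 V)))))) i j l =
  \sumz_a (L a * S a (L (i + l - a)) * S l (L (j - l)) *? (a <= j)
         - L a * S a (L (i + l - a)) * S l (L (j - l)) *? (a < l)).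
Proof.
have inner i' j' l' : mul_delta P
    (sub3 (mul_Ladj P L (one3 V)) (mul_wSz P (mul_Lw L (one3 V)))) i' j' l' =
    (S l' (L (j' - l')) *? (0 <= j') - S l' (L (j' - l')) *? (0 < l'))
      *? (i' + l' == 0).
  rewrite mul_delta_fsum.
  (* The adjoint term does not contain w and meets delta_+ only at [k = j']; the term (w lambda S/z)
     L(w) has lambda-exponent 1 and meets it only at [k = l' - 1]. Hence the conditions [0 <= j']
     and [0 < l']. *)
  pose f k := S l' (L (k - l')) *? ((i' + l' == 0) && (k == j')) *? (0 <= k).
  pose g k := S l' (L (j' - l')) *? ((i' + l' == 0) && (k == l' - 1)) *? (0 <= k).
  transitivity (\sumz_k (f k + - g k)).
    apply: eq_fsum => k; rewrite /f /g -mulNrn -mulrnDl; congr (_ *+ _).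
    rewrite /sub3 raddfB /=; congr (_ - _).
      rewrite mul_Ladj_one3 raddfMn /= -shiftzD.
      congr (S _ (L _) *+ nat_of_bool (_ && _)); lia.
    rewrite /mul_wSz -shiftz1 -shiftzD [mul_Lw _ _ _ _ _](@fsum_single _ (j' - k - 1)).
      rewrite /one3 subrr eqxx andTb.
      have [h|h] := boolP ((i' + l' == 0) && (k == l' - 1)); last first.
        by rewrite (_ : _ && _ = false) ?mulr0 ?raddf0//; apply/negP; lia.
      rewrite (_ : _ && _) ?mulr1; last lia.
      by congr (S _ (L _)); lia.
    move=> n nk; rewrite /one3 (_ : (j' - k - 1 - n == 0) = false) ?andbF ?mulr0//; lia.
  have f0 k : k != j' -> f k = 0.
    by rewrite /f => /negPf ->; rewrite andbF mul0rn.
  have g0 k : k != l' - 1 -> - g k = 0.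
    by rewrite /g => /negPf ->; rewrite andbF mul0rn oppr0.
  rewrite fsumD ?(fsum_single f0) ?(fsum_single g0) /f /g ?eqxx ?andbT.
  - rewrite mulrnBl -!mulrnA [((0 <= j')%R * _)%N]mulnC [((0 < l')%R * _)%N]mulnC.
    by congr (_ *+ _ - _ *+ (_ * _)); lia.
  - exact: fin_supp1_single f0.
  - exact: fin_supp1_single g0.
apply: eq_fsum => a.
(* The inner series lives where the exponents of z and lambda cancel, which fixes the exponent taken
   from L(z). *)
rewrite [mul_Lz _ _ _ _ _](@fsum_single _ (i + l - a)).
  rewrite inner (_ : i - (i + l - a) + (l - a) == 0); last lia.
  rewrite mulr1n mulrBr raddfB mulrBr /= !rmorphM /= !raddfMn /= -!shiftzD.
  rewrite !mulrnAr !mulrA.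
  have -> : a + (l - a) = l by lia.
  have -> : j - a - (l - a) = j - l by lia.
  by rewrite !mulNrn; congr (_ *+ _ - _ *+ _); lia.
move=> k ki; rewrite inner (_ : (i - k + (l - a) == 0) = false) ?mulr0n ?mulr0//; lia.
Qed.


Lemma mul_Lw_Ladj i j l :
  mul_Lw L (mul_Ladj P L (one3 V)) i j l = L j * S l (L (- l)) *? (i + l == 0).
Proof.
rewrite [LHS](@fsum_single _ j) => [|k kj].
  by rewrite mul_Ladj_one3 subrr eqxx andbT mulrnAr.
rewrite mul_Ladj_one3 (_ : (j - k == 0) = false) ?andbF ?mulr0//; lia.
Qed.

Lemma mul_delta_Lw_Ladj i j l :
  mul_delta P (mul_Lw L (mul_Ladj P L (one3 V))) i j l =
  (\sumz_k (S k (L (j - k)) * S l (L (k - l)) *? (0 <= k))) *? (i + l == 0).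
Proof.
rewrite mul_delta_fsum; case: (boolP (i + l == 0)) => il.
  rewrite mulr1n; apply: eq_fsum => k.
  rewrite mul_Lw_Ladj (_ : i + k + (l - k) == 0); last lia.
  rewrite mulr1n rmorphM /= -shiftzD; congr (_ * S _ (L _) *+ _); lia.
rewrite mulr0n; apply: fsum0 => k.
rewrite mul_Lw_Ladj (_ : (i + k + (l - k) == 0) = false); last lia.
by rewrite mulr0n raddf0 mul0rn.
Qed.

Lemma mul_Lz_delta_Lw_Ladj i j l :
  mul_Lz L (mul_delta P (mul_Lw L (mul_Ladj P L (one3 V)))) i j l =
  L (i + l) * \sumz_k (S k (L (j - k)) * S l (L (k - l)) *? (0 <= k)).
Proof.
rewrite [LHS](@fsum_single _ (i + l)) => [|b bil].
  rewrite mul_delta_Lw_Ladj (_ : i - (i + l) + l == 0) ?mulr1n//; lia.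
rewrite mul_delta_Lw_Ladj (_ : (i - b + l == 0) = false) ?mulr0n ?mulr0//; lia.
Qed.

Lemma fin_supp1_LL j l (c : int -> bool) :
  fin_supp1 (fun k => S k (L (j - k)) * S l (L (k - l)) *? c k).
Proof.
have [N LN] := lL; exists (`|j| + `|l| + N)%N => k.
case: (c k); rewrite ?mulr1n ?mulr0n ?eqxx// => LL.
by bound_indices; destruct e; simpl in *; lia.
Qed.

Lemma mul_LwS_delta_Lw_Ladj i j l :
  mul_LwS P L (mul_wSz P (mul_delta P (mul_Lw L (mul_Ladj P L (one3 V))))) i j l =
  L (i + l) * \sumz_k (S k (L (j - k)) * S l (L (k - l)) *? (i + l < k)).
Proof.
rewrite [LHS](@fsum_single _ (i + l)) => [|a ail]; rewrite /mul_wSz mul_delta_Lw_Ladj.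
  rewrite (_ : i + 1 + (l - (i + l) - 1) == 0) ?mulr1n; last lia.
  rewrite -shiftz1 -shiftzD (fsum_morph (raddfD (S _))); last exact: fin_supp1_LL.
  (* The operator L(w lambda S) contributes S^(i + l) and the factor w lambda S/z one more S, so
     [0 <= k] turns into the strict [i + l < k]. *)
  rewrite [in LHS](fsum_shift (- (i + l + 1))); congr (_ * _); apply: eq_fsum => k.
  rewrite raddfMn /= rmorphM /= -!shiftzD.
  by congr (S _ (L _) * S _ (L _) *+ nat_of_bool _); lia.
rewrite (_ : (i + 1 + (l - a - 1) == 0) = false) ?mulr0n ?raddf0 ?mulr0//; lia.
Qed.

(** * From the Adler coefficients to products of operators: the Lax equation *)

Definition pd_gt0 A : pseudodiff V := fun n => if 0 < n then A n else 0.

Lemma if_mulrb (b : bool) (x : V) : (if b then x else 0) = x *? b.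
Proof. by case: b. Qed.

(** With [a] the exponent of the leftmost [L], the condition [a <= j] says that the exponent [j - a]
    left to [L ∘ M ∘ L] is nonnegative. *)
Lemma fsum_mul_pos M j : laurent e M ->
  fin_supp3 (fun i l a =>
     L a * S a (L (i + l - a)) * S l (L (j - l)) *? (a <= j) * S (i + l) (M (- i))) ->
  \sumz_i \sumz_l \sumz_a (L a * S a (L (i + l - a)) * S l (L (j - l)) *? (a <= j)
     * S (i + l) (M (- i))) = (L ∘ pd_pos (L ∘ M ∘ L)) j.
Proof.
move=> lM finG; have lLM := laurent_mul lL lM.
rewrite fsum_rotate// fsum_exchange23; last exact/fin_supp3C12/fin_supp3C23.
apply: eq_fsum => a; rewrite /pd_pos if_mulrb raddfMn /= mulrnAr Num.Theory.subr_ge0.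
case: (a <= j); last first.
  by rewrite mulr0n; do 2!apply: fsum0 => ?; rewrite mulr0n mul0r.
rewrite mulr1n; pose f y := L a * S a y.
have fD : {morph f : y z / y + z} by move=> y z; rewrite /f raddfD mulrDr.
rewrite -/(f _) (fsum_morph fD (pd_mul_fin (j - a) lLM lL)) [LHS](fsum_shift a).
apply: eq_fsum => l; pose g y := f (y * S l (L (j - a - l))).
have gD : {morph g : y z / y + z} by move=> y z; rewrite /g mulrDl fD.
rewrite -/(g _) (fsum_morph gD (pd_mul_fin l lL lM)) [LHS](fsum_shift (- l)).
apply: eq_fsum => b; rewrite /g /f mulr1n !rmorphM /= -!shiftzD.
have -> : b - l + (l + a) - a = b by lia.
have -> : b - l + (l + a) = a + b by lia.
have -> : j - (l + a) = j - a - l by lia.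
have -> : l + a = a + l by lia.
have -> : - (b - l) = l - b by lia.
by ring.
Qed.

(** Here the last [L] has exponent [j - l] and the first one [a], so [a < l] is strict positivity of
    the exponent [l - a] of [L ∘ M]. *)
Lemma fsum_mul_gt0_l M j : laurent e M ->
  fin_supp3 (fun i l a =>
     L a * S a (L (i + l - a)) * S l (L (j - l)) *? (a < l) * S (i + l) (M (- i))) ->
  \sumz_i \sumz_l \sumz_a (L a * S a (L (i + l - a)) * S l (L (j - l)) *? (a < l)
     * S (i + l) (M (- i))) = (L ∘ pd_gt0 (L ∘ M) ∘ L) j.
Proof.
move=> lM finG; have lLM := laurent_mul lL lM.
have lT : laurent e (pd_gt0 (L ∘ M)).
  by apply: laurent_sub lLM => n; rewrite /pd_gt0; case: ifP; rewrite ?eqxx.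
rewrite fsum_exchange12// fsum_exchange23; last exact/fin_supp3C12.
apply: eq_fsum => l; pose f y := y * S l (L (j - l)).
have fD : {morph f : y z / y + z} by move=> y z; rewrite /f mulrDl.
rewrite -/(f _) (fsum_morph fD (pd_mul_fin l lL lT)).
apply: eq_fsum => a; rewrite /pd_gt0 if_mulrb raddfMn /= mulrnAr Num.Theory.subr_gt0.
case: (a < l); last first.
  by rewrite mulr0n /f mul0r; apply: fsum0 => ?; rewrite mulr0n mul0r.
rewrite mulr1n; pose g y := f (L a * S a y).
have gD : {morph g : y z / y + z} by move=> y z; rewrite /g raddfD mulrDr fD.
rewrite -/(g _) (fsum_morph gD (pd_mul_fin (l - a) lL lM)) [LHS](fsum_shift (a - l)).
apply: eq_fsum => b; rewrite /g /f mulr1n !rmorphM /= -!shiftzD.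
have -> : b + (a - l) + l - a = b by lia.
have -> : b + (a - l) + l = a + b by lia.
have -> : - (b + (a - l)) = l - a - b by lia.
by ring.
Qed.

(** The last [L] takes the exponent [j - k], which leaves [k] to [L ∘ M ∘ L]; the cut-off of delta_+
    is thus its positive part. *)
Lemma fsum_pos_mul M j : laurent e M ->
  fin_supp3 (fun i l k =>
     L (i + l) * (S k (L (j - k)) * S l (L (k - l)) *? (0 <= k))
     * S (i + l) (M (- i))) ->
  \sumz_i \sumz_l \sumz_k (
     L (i + l) * (S k (L (j - k)) * S l (L (k - l)) *? (0 <= k)) * S (i + l) (M (- i)))
  = (pd_pos (L ∘ M ∘ L) ∘ L) j.
Proof.
move=> lM finG; have lLM := laurent_mul lL lM.
rewrite fsum_rotate// fsum_exchange23; last exact/fin_supp3C12/fin_supp3C23.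
apply: eq_fsum => k; rewrite /pd_pos if_mulrb mulrnAl.
case: (0 <= k); last first.
  by rewrite mulr0n; do 2!apply: fsum0 => ?; rewrite mulr0n mulr0 mul0r.
rewrite mulr1n; pose f y := y * S k (L (j - k)).
have fD : {morph f : y z / y + z} by move=> y z; rewrite /f mulrDl.
rewrite -/(f _) (fsum_morph fD (pd_mul_fin k lLM lL)).
apply: eq_fsum => l; pose g y := f (y * S l (L (k - l))).
have gD : {morph g : y z / y + z} by move=> y z; rewrite /g mulrDl fD.
rewrite -/(g _) (fsum_morph gD (pd_mul_fin l lL lM)) [LHS](fsum_shift (- l)).
apply: eq_fsum => b; rewrite /g /f mulr1n.
have -> : b - l + l = b by lia.
have -> : - (b - l) = l - b by lia.
by ring.
Qed.

(** The first [L] has exponent [i + l] and the last one [j - k], so [i + l < k] is strict positivity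
    of the exponent of [M ∘ L]. *)
Lemma fsum_mul_gt0_r M j : laurent e M ->
  fin_supp3 (fun i l k =>
     L (i + l) * (S k (L (j - k)) * S l (L (k - l)) *? (i + l < k))
     * S (i + l) (M (- i))) ->
  \sumz_i \sumz_l \sumz_k (
     L (i + l) * (S k (L (j - k)) * S l (L (k - l)) *? (i + l < k))
     * S (i + l) (M (- i)))
  = (L ∘ pd_gt0 (M ∘ L) ∘ L) j.
Proof.
move=> lM finG; have lML := laurent_mul lM lL.
have lT : laurent e (pd_gt0 (M ∘ L)).
  by apply: laurent_sub lML => n; rewrite /pd_gt0; case: ifP; rewrite ?eqxx.
rewrite fsum_rotate//.
(* The index [l] is traded for [b = i + l], the exponent of the first [L]. *)
under eq_fsum => k do under eq_fsum => i do rewrite (fsum_shift (- i)).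
rewrite fsum_exchange23; last first.
  by case: finG => K GK; exists (K + K)%N => k i b /GK; case; split; lia.
apply: eq_fsum => k; pose f y := y * S k (L (j - k)).
have fD : {morph f : y z / y + z} by move=> y z; rewrite /f mulrDl.
rewrite -/(f _) (fsum_morph fD (pd_mul_fin k lL lT)).
apply: eq_fsum => b; rewrite /pd_gt0 if_mulrb raddfMn /= mulrnAr Num.Theory.subr_gt0.
have ib i : i + (b - i) = b by lia.
under eq_fsum => i do rewrite ib.
case: (b < k); last first.
  by rewrite mulr0n /f mul0r; apply: fsum0 => ?; rewrite mulr0n mulr0 mul0r.
rewrite mulr1n; pose g y := f (L b * S b y).
have gD : {morph g : y z / y + z} by move=> y z; rewrite /g raddfD mulrDr fD.
rewrite -/(g _) (fsum_morph gD (pd_mul_fin (k - b) lM lL)) [LHS](fsum_reflect 0).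
apply: eq_fsum => c; rewrite /g /f mulr1n !rmorphM /= -!shiftzD.
have -> : b - (0 - c) = b + c by lia.
have -> : - (0 - c) = c by lia.
have -> : k - (b + c) = k - b - c by lia.
by ring.
Qed.

Lemma variation_adler3 M j : adler3 P L -> laurent e M -> L ∘ M = M ∘ L ->
  variation (L j) L M = pd_comm P L (pd_pos (L ∘ M ∘ L)) j.
Proof.
move=> adlerL lM LM.
pose x i l := S (i + l) (M (- i)).
pose G1 i l a := L a * S a (L (i + l - a)) * S l (L (j - l)) *? (a <= j).
pose G2 i l a := L a * S a (L (i + l - a)) * S l (L (j - l)) *? (a < l).
pose G3 i l k := L (i + l) * (S k (L (j - k)) * S l (L (k - l)) *? (0 <= k)).
pose G4 i l k := L (i + l) * (S k (L (j - k)) * S l (L (k - l)) *? (i + l < k)).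
(* In every term the exponents of the three factors [L] and of [M] add up to [j] and are bounded on
   the same side, hence on both sides; the factor 4 is a crude allowance. *)
have [[N LN] [R MR]] := (lL, lM).
have [fin1 fin2] : fin_supp3 (fun i l a => G1 i l a * x i l) /\
                   fin_supp3 (fun i l a => G2 i l a * x i l).
  by split; exists (4 * (`|j| + N + R))%N => i l a nz; rewrite /G1 /G2 /x in nz;
    bound_indices; destruct e; simpl in *; split; lia.
have [fin3 fin4] : fin_supp3 (fun i l k => G3 i l k * x i l) /\
                   fin_supp3 (fun i l k => G4 i l k * x i l).
  by split; exists (4 * (`|j| + N + R))%N => i l k nz; rewrite /G3 /G4 /x in nz;
    bound_indices; destruct e; simpl in *; split; lia.
(* These bounds are for fixed [i] and [l] and without [x]: the Adler coefficient has to be split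
   before it is multiplied by [x i l]. *)
have [finl1 finl2] :
    (forall i l, fin_supp1 (G1 i l)) /\ (forall i l, fin_supp1 (G2 i l)).
  by split=> i l; exists (`|i| + `|l| + N)%N => a nz; rewrite /G1 /G2 in nz;
    bound_indices; destruct e; simpl in *; lia.
have mulDl (y : V) : {morph *%R^~ y : u v / u + v} by move=> u v; rewrite mulrDl.
transitivity
  (\sumz_i \sumz_l \sumz_a (G1 i l a * x i l)
     - \sumz_i \sumz_l \sumz_a (G2 i l a * x i l)
   - (\sumz_i \sumz_l \sumz_k (G3 i l k * x i l)
     - \sumz_i \sumz_l \sumz_k (G4 i l k * x i l))).
  have [f1 f2] := (fin_supp3_fsum fin1, fin_supp3_fsum fin2).
  have [f3 f4] := (fin_supp3_fsum fin3, fin_supp3_fsum fin4).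
  rewrite -(fsum2B f1 f2) -(fsum2B f3 f4) -fsum2B; try exact: fin_supp2B.
  apply: eq_fsum => i; apply: eq_fsum => l.
  rewrite adlerL /adler3_rhs /sub3 adler3_left mul_Lz_delta_Lw_Ladj.
  rewrite mul_LwS_delta_Lw_Ladj (fsumB (finl1 i l) (finl2 i l)).
  rewrite !(fsum_morph (mulrDr (L (i + l)))); try exact: fin_supp1_LL.
  rewrite !mulrBl -shiftzD [l + i]addrC -/(x i l).
  rewrite !(fsum_morph (mulDl (x i l))) //.
    have [K LLK] := fin_supp1_LL j l (fun k => i + l < k); exists K => k.
    by move=> /neq0_mul[_ /LLK].
  have [K LLK] := fin_supp1_LL j l (fun k => 0 <= k); exists K => k.
  by move=> /neq0_mul[_ /LLK].
rewrite (fsum_mul_pos lM fin1) (fsum_mul_gt0_l lM fin2).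
rewrite (fsum_pos_mul lM fin3) (fsum_mul_gt0_r lM fin4) LM /pd_comm.
by ring.
Qed.

(** * The derivation {int a, -}, acting on elements and on operators *)

Section Derivation.
Variable a : V.
Local Notation D := (bracket1 P a).
Local Notation "'D*' A" := (fun n : int => D (A n)) (at level 10).

Lemma bracket_fin b c : fin_supp1 (bracket P b c).
Proof. exact: fin_supp1_finite (bracket_finite P b c). Qed.

Lemma bracket1M x y : D (x * y) = D x * y + x * D y.
Proof.
have mulDl (z : V) : {morph *%R^~ z : u v / u + v} by move=> u v; rewrite mulrDl.
rewrite [x * D y]mulrC.
rewrite /bracket1 (fsum_morph (mulDl y) (bracket_fin a x)).
rewrite (fsum_morph (mulDl x) (bracket_fin a y)) -fsumD.
- by apply: eq_fsum => n; rewrite bracket_leibniz.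
- by have [K aK] := bracket_fin a x; exists K => n /neq0_mul[/aK].
- by have [K aK] := bracket_fin a y; exists K => n /neq0_mul[/aK].
Qed.

Lemma bracket1_shiftz n x : D (S n x) = S n (D x).
Proof.
have Snat (k : nat) y : D (S k%:Z y) = S k%:Z (D y).
  by elim: k => // k IHk; rewrite -addn1 PoszD !shiftzS bracket1_shiftr IHk.
case: n => k; first exact: Snat.
by rewrite -[x in RHS](shiftzK (Negz k)) NegzE opprK Snat -shiftzD addNr.
Qed.

Lemma bracket1r0 : D 0 = 0.
Proof. by apply: (addrI (D 0)); rewrite -bracket1Dr !addr0. Qed.

Lemma laurent_bracket1 f A : laurent f A -> laurent f (D* A).
Proof.
by apply: laurent_sub => n; apply: contra_neq => ->; exact: bracket1r0.
Qed.

Lemma bracket1_pd_mul f A B : laurent f A -> laurent f B ->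
  D* (A ∘ B) = fun n => ((D* A) ∘ B) n + (A ∘ (D* B)) n.
Proof.
move=> lA lB; apply: funext => n.
rewrite (fsum_morph (bracket1Dr P a) (pd_mul_fin n lA lB)).
rewrite -fsumD.
- by apply: eq_fsum => i; rewrite bracket1M bracket1_shiftz.
- exact: pd_mul_fin (laurent_bracket1 lA) lB.
- exact: pd_mul_fin lA (laurent_bracket1 lB).
Qed.

End Derivation.

Lemma pd_mulBl f A B C : laurent f A -> laurent f B -> laurent f C ->
  (fun n => A n - B n) ∘ C = fun n => (A ∘ C) n - (B ∘ C) n.
Proof.
move=> lA lB lC; apply: funext => n.
rewrite -(fsumB (pd_mul_fin n lA lC) (pd_mul_fin n lB lC)).
by apply: eq_fsum => i; rewrite mulrBl.
Qed.

Lemma pd_mulBr f A B C : laurent f A -> laurent f B -> laurent f C ->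
  A ∘ (fun n => B n - C n) = fun n => (A ∘ B) n - (A ∘ C) n.
Proof.
move=> lA lB lC; apply: funext => n.
rewrite -(fsumB (pd_mul_fin n lA lB) (pd_mul_fin n lA lC)).
by apply: eq_fsum => i; rewrite raddfB mulrBr.
Qed.

Lemma pd_comm_mulr f A B C : laurent f A -> laurent f B -> laurent f C ->
  pd_comm P A (B ∘ C) = fun n => (pd_comm P A B ∘ C) n + (B ∘ pd_comm P A C) n.
Proof.
move=> lA lB lC; apply: funext => n; rewrite /pd_comm.
rewrite (pd_mulBl (laurent_mul lA lB) (laurent_mul lB lA) lC).
rewrite (pd_mulBr lB (laurent_mul lA lC) (laurent_mul lC lA)).
rewrite (pd_mulA lA lB lC) (pd_mulA lB lA lC) (pd_mulA lB lC lA).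
by rewrite addrA subrK.
Qed.

(** Both the coefficientwise action and the commutator with [B] are derivations of the operator
    product; agreeing on [A], they agree on its powers. *)
Lemma bracket1_exp_comm f a A B k : laurent f A -> laurent f B ->
  (fun n => bracket1 P a (A n)) = pd_comm P B A ->
  (fun n => bracket1 P a (pd_exp P A k n)) = pd_comm P B (pd_exp P A k).
Proof.
move=> lA lB DA; elim: k => [|k IHk].
  apply: funext => n; rewrite /pd_comm pd_mul1r pd_mulr1 subrr /= /pd_one.
  case: eqP => _; last exact: bracket1r0.
  have /eqP := bracket1M a 1 1; rewrite !mulr1 mul1r -subr_eq0 opprD addrA.
  by rewrite subrr sub0r oppr_eq0 => /eqP.
have lAk := laurent_exp k lA.
by rewrite (bracket1_pd_mul a lA lAk) IHk DA (pd_comm_mulr lB lA lAk).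
Qed.

(** * Residues of commutators, and the Jacobi identity at lambda = mu = 1 *)

Lemma total_difference_shiftz n x : exists c, S n x - x = shift P c - c.
Proof.
have Snat (k : nat) y : exists c, S k%:Z y - y = shift P c - c.
  elim: k => [|k [c IHk]]; first by exists 0; rewrite subrr raddf0 subrr.
  exists (c + S k%:Z y); rewrite -addn1 PoszD shiftzS (raddfD (shift P)).
  by rewrite -[LHS](subrKA (S k%:Z y)) IHk; ring.
case: n => k; first exact: Snat.
(* For a negative power, the nonnegative case at [S (Negz k) x] gives the same difference with
   opposite sign. *)
have [c Ec] := Snat k.+1 (S (Negz k) x); exists (- c).
apply: oppr_inj; rewrite opprB (raddfN (shift P)) opprK opprD opprK -Ec.
by rewrite -shiftzD NegzE addrN.
Qed.

Lemma total_difference_fsum (G : int -> V) :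
  (forall i, exists c, G i = shift P c - c) -> fin_supp1 G ->
  exists c, \sumz_i G i = shift P c - c.
Proof.
move=> Gd [K GK]; rewrite (fsum_segment GK).
have [c Gc] := choice Gd; exists (\sum_(i <- segment K) c i).
by rewrite raddf_sum -sumrB; apply: eq_bigr => i _.
Qed.

(** The term [i] of the residue of [A ∘ B] is S^i applied to the term [- i] of that of [B ∘ A], so
    the difference is a sum of elements S^i(x) - x. *)
Lemma mres_comm f A B : laurent f A -> laurent f B ->
  exists c, mres (pd_comm P A B) = shift P c - c.
Proof.
move=> lA lB; have finA := pd_mul_fin 0 lA lB.
have finB : fin_supp1 (fun i => B (- i) * S (- i) (A (0 - - i))).
  have [K BK] := pd_mul_fin 0 lB lA; exists K => i /BK; lia.
have -> : mres (pd_comm P A B) =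
    \sumz_i (A i * S i (B (0 - i)) - B (- i) * S (- i) (A (0 - - i))).
  rewrite fsumB// /mres /pd_comm; congr (_ - _).
  by rewrite [LHS](fsum_reflect 0); apply: eq_fsum => i; rewrite sub0r.
apply: total_difference_fsum; last exact: fin_supp1B.
move=> i; have [c Ec] := total_difference_shiftz i (B (- i) * S (- i) (A i)).
exists c; rewrite -Ec rmorphM /= -shiftzD subrr shiftz0 !sub0r opprK.
by rewrite [X in X - _]mulrC.
Qed.

Lemma bracket1_jacobi a b u :
  bracket1 P a (bracket1 P b u) - bracket1 P b (bracket1 P a u)
  = bracket1 P (bracket1 P a b) u.
Proof.
have brDr c n : {morph (fun x => bracket P c x n) : x y / x + y}.
  by move=> x y; rewrite -[x in LHS]scale1r bracket_linearr scale1r.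
have brDl c n : {morph (fun x => bracket P x c n) : x y / x + y}.
  by move=> x y; rewrite bracketDl.
have br0r c n : bracket P c 0 n = 0.
  by apply: (addrI (bracket P c 0 n)); rewrite -brDr !addr0.
have fin c d : fin_supp2 (fun n m => bracket P c (bracket P d u n) m).
  have [K dK] := bracket_fin d u; apply: (@fin_supp2_rows _ _ K) => [n m|n].
    by move=> nz; apply: dK; apply: contra_neq nz => ->.
  exact: bracket_fin.
have iter c d : bracket1 P c (bracket1 P d u) =
    \sumz_m \sumz_n bracket P c (bracket P d u n) m.
  by apply: eq_fsum => m; rewrite (fsum_morph (brDr c m) (bracket_fin d u)).
(* Finiteness of the right-hand family is read off from the left-hand one through the Jacobi
   identity itself. *)
have fin2 : fin_supp2 (fun m n => bracket P (bracket P a b (m - n)) u n).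
  have [K nz] := fin_supp2B (fin_supp2C (fin a b)) (fin b a).
  by exists K => m n; rewrite -bracket_jacobi => /nz.
rewrite iter (iter b a) [X in _ - X]fsum_exchange; last exact/fin_supp2C/fin.
rewrite -(fsum2B (fin_supp2C (fin a b)) (fin b a)).
under eq_fsum => m do under eq_fsum => n do rewrite bracket_jacobi.
rewrite (fsum_exchange fin2); apply: eq_fsum => n.
rewrite (fsum_morph (brDl u n) (bracket_fin a b)) [RHS](fsum_shift (- n)).
by [].
Qed.

Lemma bracket1Zl k a c : bracket1 P (k *: a) c = k *: bracket1 P a c.
Proof.
rewrite /bracket1 (fsum_morph (scalerDr k) (bracket_fin a c)).
apply: eq_fsum => n; rewrite -[k *: a]addr0 bracket_linearl.
by rewrite bracket0l addr0.
Qed.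

Lemma bracket1Zr k a c : bracket1 P a (k *: c) = k *: bracket1 P a c.
Proof.
rewrite /bracket1 (fsum_morph (scalerDr k) (bracket_fin a c)).
apply: eq_fsum => n; rewrite -[k *: c]addr0 bracket_linearr.
have /(addrI (bracket P a c n)) -> :
    bracket P a c n + bracket P a 0 n = bracket P a c n + 0.
  by rewrite -[X in X + _]scale1r -bracket_linearr scale1r !addr0.
by rewrite addr0.
Qed.

Lemma intf_eq0 a : (exists c, a = shift P c - c) -> intf P a = 0.
Proof.
move=> a0; have -> : 0 = intf P 0 by rewrite /intf raddf0.
by apply/eqP; rewrite -Quotient.idealrBE subr0; apply/asboolP.
Qed.

(** * The Lax equations and the involution of the Hamiltonians *)

Section Hierarchy.
Hypotheses (charF0 : [pchar F] =i pred0) (adlerL : adler3 P L).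
Local Notation h := (hamiltonian P L).

(** The multiplicity [n] from varying L^n cancels the denominator of [h n] in characteristic 0, and
    the minus sign reverses the commutator given by [variation_adler3] for M = L^(n-1). *)
Lemma bracket1_hamiltonian n j : (0 < n)%N ->
  bracket1 P (h n) (L j) = pd_comm P (pd_pos (pd_exp P L n.+1)) L j.
Proof.
case: n => // n _; rewrite /hamiltonian /= bracket1Zl.
rewrite -[pd_mul _ _ _]/(pd_exp P L n.+1) (bracket1_mres_exp _ _ lL).
have lLn := laurent_exp n lL.
have LnL : pd_exp P L n ∘ L = pd_exp P L n.+1.
  by rewrite -addn1 (pd_expD n 1 lL) pd_exp1.
rewrite (variation_adler3 _ adlerL lLn (esym LnL)).
rewrite -(pd_mulA lL lLn lL) LnL -scaler_nat scalerA mulNr mulVf.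
  by rewrite scaleN1r /pd_comm opprB.
by have /pcharf0P -> := charF0.
Qed.

Lemma hamiltonian_involution m n :
  exists c, bracket1 P (h m) (h n) = shift P c - c.
Proof.
have zero x : x = 0 -> exists c, x = shift P c - c.
  by move=> ->; exists 0; rewrite raddf0 subrr.
have [->|m_gt0] := posnP m.
  (* The flow of h_0 = 0 has no Lax form here, so [m = 0] is treated apart: 0 is written as [0 *: 0]
     to use linearity. *)
  by apply: zero; rewrite /hamiltonian eqxx -(scale0r 0) bracket1Zl !scale0r.
rewrite [h n]/hamiltonian; case: eqP => _; first exact/zero/bracket1r0.
have lB : laurent e (pd_pos (pd_exp P L m.+1)).
  apply: laurent_sub (laurent_exp m.+1 lL) => i.
  by rewrite /pd_pos; case: ifP; rewrite ?eqxx.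
have DL : (fun i => bracket1 P (h m) (L i)) =
    pd_comm P (pd_pos (pd_exp P L m.+1)) L.
  by apply: funext => i; exact: bracket1_hamiltonian.
have [c Ec] := mres_comm lB (laurent_exp n lL).
exists (- n%:R^-1 *: c); rewrite bracket1Zr linearZ /= -scalerBr -Ec.
by rewrite -(bracket1_exp_comm n lL lB DL).
Qed.

End Hierarchy.
End Operators.

Theorem theorem8p1 (F : fieldType) (charF0 : [pchar F] =i pred0)
    (V : comAlgType F) (P : mPVA V) (L : pseudodiff V)
    (L_laurent : laurent_Sinv L \/ laurent_S L) (L_adler : adler3 P L) :
  let h (n : nat) : functional P := intf P (hamiltonian P L n) in
  (forall m n : nat, lie (h m) (h n) = 0) /\
  [/\ forall m n : nat, compatible (h m) (h n),
      forall n : nat, (0 < n)%N -> forall j : int,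
        act (h n) (L j) = pd_comm P (pd_pos (pd_exp P L n.+1)) L j
    & forall m n : nat, integral_of_motion (h n) (h m)].
Proof.
move=> h; have [e lL] := laurent_either L_laurent.
have inv := hamiltonian_involution lL charF0 L_adler.
have lie0 m n : lie (h m) (h n) = 0.
  by rewrite lieE; apply/intf_eq0/inv.
split=> //; split=> [m n u|n n_gt0 j|m n]; last exact: lie0.
  apply/eqP; rewrite /h !actE -subr_eq0 bracket1_jacobi.
  have [c ->] := inv m n; apply/eqP.
  (* The commutator of the two flows is the action of a total difference, which vanishes because
     [shift P c] and [c] act alike at lambda = 1. *)
  apply: (addIr (bracket1 P c u)).
  by rewrite -bracket1Dl subrK bracket1_shiftl add0r.
by rewrite actE; apply: bracket1_hamiltonian lL _ _ _ _ n_gt0.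
Qed.
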